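(* Consider a task $m$ comprising $K_m\ge2$ subtasks, divided into $B_m\ge1$ epochs, served by VUCB1 learning (defined in the context). Then the total learning regret $R_m$ of VUCB1 is $O(B_m\ln K_m)$; that is, there is a constant $c$, depending only on $V$, $C_m$, $\beta$, an upper bound on the numbers $|\mathcal A_{m,b}|$ of BSs available in an epoch, and a positive lower bound on the gaps $\delta_{n,b}$ ($1\le b\le B_m$, $n\in\mathcal A_{m,b}\setminus\{a_{m,b}^*\}$), such that $$R_m\le c\,B_m\ln K_m .$$
   Context: **Epochs.** The subtasks $k=1,\dots,K_m$ of task $m$ are split into $B_m$ consecutive epochs; epoch $b$ consists of the subtasks $K_{m,b-1}+1,\dots,K_{m,b}$, where $0=K_{m,0}<K_{m,1}<\dots<K_{m,B_m}=K_m$. During epoch $b$ the set of available base stations (BSs) is the finite nonempty set $\mathcal A_{m,b}$. Each BS $n$ is available exactly during an interval of subtasks $[u_n,v_n]$ (a BS reappearing later is treated as a new BS), where $u_n$ is the subtask at which it appears. The epochs and lifespans are fixed but unknown to the user in advance. **Costs and observations.** Each BS $n$ has a per-subtask cost $z(m,n)=Vd(m,n)+q(m)e(m,n)\ge0$ (expected delay $d$, expected energy $e$, constants $V>0$, $q(m)\ge0$), unknown to the user and constant during the task. Each time a subtask is offloaded to BS $n$ the user observes $\tilde z(m,n)=V\tilde d(m,n)+q(m)\tilde e(m,n)$; the successive observations from BS $n$ are i.i.d. with mean $z(m,n)$, with values in $[0,\beta]$, $\beta>0$, and are independent across BSs. In each epoch $b$ there is a unique optimal BS $a_{m,b}^*$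 minimizing $z(m,n)$ over $\mathcal A_{m,b}$, and $\delta_{n,b}=(z(m,n)-z(m,a_{m,b}^* ))/\beta$ for $n\in\mathcal A_{m,b}$. Each handover costs $C_m\ge0$. **VUCB1 learning.** At the beginning of each epoch, every newly appeared available BS that has not been used yet is used once (one subtask each). For every other subtask $k$, the user offloads to $$a_m^k\in\arg\min_{n}\left\{\bar z_{m,n}-\beta\sqrt{\frac{2\ln(k-u_n)}{\theta_{m,n}}}\right\},$$ the minimum being over the currently available BSs, where $\theta_{m,n}$ is the number of subtasks before $k$ (in all epochs) offloaded to BS $n$, and $\bar z_{m,n}$ is the average of the corresponding observations of $\tilde z(m,n)$. **Regret.** With $\boldsymbol a_m=(a_m^1,\dots,a_m^{K_m})$ the resulting random sequence, $$R_m=\sum_{b=1}^{B_m}\mathbb E\left[\sum_{k=K_{m,b-1}+1}^{K_{m,b}}\bigl(z(m,a_m^k)-z(m,a_{m,b}^* )\bigr)\right]+V C_m\,\mathbb E\left[\sum_{k=2}^{K_m}\mathbb I\{a_m^k\ne a_m^{k-1}\}\right].$$ *)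

(* Defs.v *)
From HB Require Import structures.
From mathcomp Require Import all_boot all_order all_algebra finmap.
From mathcomp Require Import all_classical all_reals all_analysis.

Set Implicit Arguments.
Unset Strict Implicit.
Unset Printing Implicit Defensive.

Import Order.TTheory GRing.Theory Num.Theory.

Local Open Scope classical_set_scope.
Local Open Scope ring_scope.

Definition mutually_independent (R : realType) (d : measure_display)
    (T : measurableType d) (P : probability T R) (J : choiceType)
    (X : J -> {RV P >-> R}) : Prop :=
  forall (S : {fset J}) (E : J -> set R),
    (forall j, j \in S -> measurable (E j)) ->
    P (\bigcap_(j in [set` S]) (X j @^-1` E j)) =
    (\prod_(j <- S) P (X j @^-1` E j))%E.

Definition argmin (BS : finType) (R : realType) (A : {set BS})
    (f : BS -> R) : {set BS} :=
  [set n in A | [forall n' in A, f n <= f n']]%SET.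

(* A single task is considered, so the index m is dropped everywhere. Subtasks
   and epochs are numbered from 1: epoch b consists of the subtasks
   Kend b.-1 < k <= Kend b, and Kend B is the total number of subtasks. *)
Definition epoch_ends (B : nat) (Kend : nat -> nat) : Prop :=
  Kend 0%N = 0%N /\ forall b : nat, (b < B)%N -> (Kend b < Kend b.+1)%N.

Definition in_epoch (B : nat) (Kend : nat -> nat) (b k : nat) : bool :=
  (1 <= b <= B)%N && (Kend b.-1 < k <= Kend b)%N.

(* u n and v n are the first and last subtasks at which n is available; since
   subtasks are numbered from 1, 1 <= u n is part of the meaning of u n. *)
Definition lifespans (BS : finType) (B : nat) (Kend : nat -> nat)
    (A : nat -> {set BS}) (u v : BS -> nat) : Prop :=
  (forall n, (1 <= u n <= v n)%N && (v n <= Kend B)%N) /\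
  (forall b k n, in_epoch B Kend b k -> (n \in A b) = (u n <= k <= v n)%N).

Definition cost (BS : finType) (R : realType) (V q : R) (dl en : BS -> R)
    (n : BS) : R :=
  V * dl n + q * en n.

(* The j-th observation (j = 0, 1, ...) made from base station n. *)
Definition obs (BS : finType) (R : realType) (d : measure_display)
    (T : measurableType d) (P : probability T R) (V q : R)
    (Dl En : BS -> nat -> {RV P >-> R}) (n : BS) (j : nat) : {RV P >-> R} :=
  V *: (Dl n j : {mfun T >-> R}) + q *: (En n j : {mfun T >-> R}).

Definition gap (BS : finType) (R : realType) (beta : R) (z : BS -> R)
    (astar : nat -> BS) (n : BS) (b : nat) : R :=
  (z n - z (astar b)) / beta.

Section Policy.
Variables (BS : finType) (R : realType) (T : Type).
(* Z n j w is the j-th observation (from 0) made from n, so that subtask k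
   reveals the observation of a k w whose rank is the number of earlier uses. *)
Variables (Z : BS -> nat -> T -> R) (a : nat -> T -> BS).

Definition uses (n : BS) (k : nat) (w : T) : nat :=
  (\sum_(1 <= i < k) (a i w == n))%N.

Definition observed (k : nat) (w : T) : R :=
  Z (a k w) (uses (a k w) k w) w.

Definition avg_obs (n : BS) (k : nat) (w : T) : R :=
  (\sum_(1 <= i < k | a i w == n) observed i w) / (uses n k w)%:R.

Definition vucb1_index (beta : R) (u : BS -> nat) (k : nat) (w : T)
    (n : BS) : R :=
  avg_obs n k w - beta * Num.sqrt (2 * ln (k - u n)%:R / (uses n k w)%:R).

Definition unused (An : {set BS}) (k : nat) (w : T) : {set BS} :=
  [set n in An | uses n k w == 0%N]%SET.

(* Newly appeared stations are tried first, in any order, and ties in the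
   arg min are broken arbitrarily. An epoch may be shorter than the number of
   its new stations; the untried ones then come first in the next epoch, so the
   index is only evaluated when uses n k w > 0, hence k > u n, for all
   available n. *)
Definition vucb1 (beta : R) (B : nat) (Kend : nat -> nat)
    (A : nat -> {set BS}) (u : BS -> nat) : Prop :=
  forall (b k : nat) (w : T), in_epoch B Kend b k ->
    if unused (A b) k w != finset.set0 then a k w \in unused (A b) k w
    else a k w \in argmin (A b) (vucb1_index beta u k w).

End Policy.

Definition epoch_regret (BS : finType) (R : realType) (T : Type)
    (Kend : nat -> nat) (z : BS -> R) (astar : nat -> BS) (a : nat -> T -> BS)
    (b : nat) (w : T) : R :=
  \sum_((Kend b.-1).+1 <= k < (Kend b).+1) (z (a k w) - z (astar b)).

Definition handovers (BS : finType) (R : realType) (T : Type) (K : nat)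
    (a : nat -> T -> BS) (w : T) : R :=
  \sum_(2 <= k < K.+1) (a k w != a k.-1 w)%:R.

Definition regret (BS : finType) (R : realType) (d : measure_display)
    (T : measurableType d) (P : probability T R) (V C : R) (B : nat)
    (Kend : nat -> nat) (z : BS -> R) (astar : nat -> BS)
    (a : nat -> T -> BS) : \bar R :=
  (\sum_(1 <= b < B.+1) 'E_P[epoch_regret Kend z astar a b]
   + (V * C)%:E * 'E_P[handovers R (Kend B) a])%E.

(* Main.v *)
(** In epoch b let m be the optimal station, and suppose a suboptimal n is chosen
at subtask k after at least l >= 8 ln K / gap0^2 uses. Then the confidence radius
of n is at most half its gap, so n can only beat m in the arg min if the average
of m overestimates z m by a full radius, or that of n underestimates z n by one.
The number of uses of m (or n) being random, these two events are enlarged to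
"some partial average of s <= t observations deviates by the radius
beta sqrt(2 ln t / s)", with t = k - u m (or k - u n); this makes them depend on
the observations only. By Hoeffding's inequality each s contributes at most
t^-4, so the event has probability at most t^-3 <= t^-2, which is summable. Hence
each suboptimal station is chosen at most l + 4 times per epoch on average. The
epoch regret and the handovers are both controlled by the number of suboptimal
choices, up to one handover per epoch. *)

Require Import Defs.
From HB Require Import structures.
From mathcomp Require Import all_boot all_order all_algebra finmap.
From mathcomp Require Import all_classical all_reals all_analysis.
From mathcomp Require Import measurable_realfun.
From mathcomp Require Import zify ring lra.

Set Implicit Arguments.
Unset Strict Implicit.
Unset Printing Implicit Defensive.

Import Order.TTheory GRing.Theory Num.Theory.
Import numFieldNormedType.Exports.

Local Open Scope classical_set_scope.
Local Open Scope ring_scope.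

(** * Hoeffding's inequality *)

Lemma le_derive1_ge0 (R : realType) (f df : R -> R) (h : R) : 0 <= h ->
  (forall x, is_derive x (1 : R) f (df x)) -> (forall x, 0 <= x -> 0 <= df x) ->
  f 0 <= f h.
Proof.
move=> h0 fdf df0.
apply: (@ger0_derive1_le_cc R f 0 h) => //; rewrite ?in_itv /= ?lexx ?h0//.
- by move=> x; rewrite in_itv /= => /andP[/ltW x0 _]; rewrite derive1E derive_val df0.
- by apply: derivable_within_continuous => x _; have [] := fdf x.
Qed.

(** * Hoeffding's lemma for a Bernoulli variable *)

Section HoeffdingLemma.
Variables (R : realType) (p : R).
Hypothesis p01 : 0 <= p <= 1.

(** The moment generating function of a Bernoulli variable of parameter [p], built from operations
    on functions so that instance resolution finds its derivative. *)
Let m : R -> R := cst (1 - p) + p \*: expR.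

Let mE h : m h = 1 - p + p * expR h. Proof. by []. Qed.

Let m_gt0 h : 0 < m h.
Proof.
have e0 := expR_gt0 h; case/andP: p01 => p0 p1; rewrite mE.
have [->|pn0] := eqVneq p 0; first by rewrite subr0 mul0r addr0.
have pe : 0 < p * expR h by rewrite mulr_gt0// lt_neqAle eq_sym pn0.
by rewrite ltr_wpDl// subr_ge0.
Qed.

Let is_derive_m (h : R) : is_derive h (1 : R) m (p * expR h).
Proof. by apply: is_derive_eq; rewrite add0r. Qed.

(** This is the derivative of [phi] below, with p e^h / m written as 1 - (1 - p) / m so that only 1
    / m remains to be differentiated. *)
Let slope : R -> R := cst (p - 1) + 4^-1 \*: id + (1 - p) \*: (fun h => (m h)^-1).

Let is_derive_slope (h : R) :
  is_derive h (1 : R) slope (4^-1 - (1 - p) * (p * expR h) / (m h) ^+ 2).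
Proof.
have m0 : m h != 0 by rewrite gt_eqF.
have [dm dmE] := is_derive_m h.
have dV : is_derive h (1 : R) (fun h => (m h)^-1) (- (m h) ^- 2 *: (p * expR h)).
  apply: DeriveDef; first exact: (derivableV m0 dm).
  by rewrite (deriveV m0 dm) dmE.
by apply: is_derive_eq; rewrite add0r /GRing.scale/= mulr1; ring.
Qed.

(** The slope vanishes at 0, and its derivative is 1/4 - x y / (x + y)^2 with x = 1 - p and y = p
    e^h, which is nonnegative because (x - y)^2 is. *)
Let slope_ge0 h : 0 <= h -> 0 <= slope h.
Proof.
move=> h0; have <- : slope 0 = 0.
  have -> : slope 0 = p - 1 + 4^-1 * 0 + (1 - p) * (m 0)^-1 by [].
  by rewrite mE expR0; field; apply/eqP; lra.
apply: (le_derive1_ge0 h0 is_derive_slope) => x _.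
rewrite subr_ge0 ler_pdivrMr ?exprn_gt0// mE.
have -> : 4^-1 * (1 - p + p * expR x) ^+ 2 =
    (1 - p) * (p * expR x) + 4^-1 * (1 - p - p * expR x) ^+ 2 by field.
by rewrite lerDl mulr_ge0// sqr_ge0.
Qed.

Let phi : R -> R := p \*: id + 8^-1 \*: (id ^+ 2) - (@ln R \o m).

Let is_derive_phi (h : R) : is_derive h (1 : R) phi (slope h).
Proof.
have lm := is_derive1_ln (m_gt0 h).
apply: is_derive_eq.
have -> : slope h = p - 1 + 4^-1 * h + (1 - p) * (m h)^-1 by [].
have := m_gt0 h; rewrite /GRing.scale/= !mulr1 expr1 mE => m0.
by field; apply/eqP; lra.
Qed.

(** After taking logarithms this says that [phi] is nonnegative: it vanishes at 0 and its derivative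
    [slope] is nonnegative. *)
Lemma bernoulli_mgf_le h : 0 <= h ->
  1 - p + p * expR h <= expR (p * h + h ^+ 2 / 8).
Proof.
move=> h0; rewrite -[leLHS]lnK ?ler_expR; last exact: m_gt0.
have := le_derive1_ge0 h0 is_derive_phi slope_ge0.
have -> : phi 0 = p * 0 + 8^-1 * 0 ^+ 2 - ln (1 - p + p * expR 0) by [].
have -> : phi h = p * h + 8^-1 * h ^+ 2 - ln (1 - p + p * expR h) by [].
by rewrite expR0 mulr1 subrK ln1; lra.
Qed.

End HoeffdingLemma.

(** * Expectation of a product of independent variables *)

Section IntegralMulComp.
Local Open Scope ereal_scope.
Import HBNNSimple.

(* Stated for two pairs (W, X), so that no density measure is needed. *)
Lemma eq_integral_mul_comp (R : realType) (d : measure_display) (T : measurableType d)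
    (P : {measure set T -> \bar R}) (W1 W2 : T -> \bar R) (X1 X2 : T -> R)
    (f : R -> \bar R) :
  measurable_fun setT W1 -> measurable_fun setT W2 ->
  measurable_fun setT X1 -> measurable_fun setT X2 ->
  (forall w, 0 <= W1 w) -> (forall w, 0 <= W2 w) ->
  (forall w, W1 w \is a fin_num) -> (forall w, W2 w \is a fin_num) ->
  (forall E, measurable E -> \int[P]_w (W1 w * (\1_E (X1 w))%:E) =
                             \int[P]_w (W2 w * (\1_E (X2 w))%:E)) ->
  measurable_fun setT f -> (forall x, 0 <= f x) ->
  \int[P]_w (W1 w * f (X1 w)) = \int[P]_w (W2 w * f (X2 w)).
Proof.
move=> mW1 mW2 mX1 mX2 W10 W20 W1f W2f E12 mf f0.
pose h := nnsfun_approx measurableT mf.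
have mh n : measurable_fun setT (h n : R -> R) by exact: measurable_funP.
(* Monotone convergence along simple functions increasing to [f]. In the limit formula the pair (W,
   X) enters only through integrals of W against indicators of X, which agree for the two pairs. *)
have main (W : T -> \bar R) (X : T -> R) : measurable_fun setT W ->
    measurable_fun setT X -> (forall w, 0 <= W w) -> (forall w, W w \is a fin_num) ->
    \int[P]_w (W w * f (X w)) =
    lim ((\sum_(y \in range (h n))
       (y%:E * \int[P]_w (W w * (\1_(h n @^-1` [set y]) (X w) : R)%:E)))
         @[n --> \oo]).
  move=> mW mX W0 Wf.
  under eq_integral => w _.
    have -> : W w * f (X w) = lim ((W w * (h n (X w))%:E) @[n --> \oo]).
      apply/esym/cvg_lim => //; apply: cvgeZl => //.
      by apply: (@cvg_nnsfun_approx _ _ _ _ measurableT f mf) => //.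
    over.
  have mk n y : measurable_fun setT (fun w => (\1_(h n @^-1` [set y]) (X w) : R)%:E).
    apply/measurable_EFinP;
      apply: (@measurableT_comp _ _ _ _ _ _ (\1_(h n @^-1` [set y]) : R -> R)) => //.
  rewrite monotone_convergence//; first last.
  - by move=> w _ a b ab; rewrite lee_wpmul2l// lee_fin; exact/lefP/nd_nnsfun_approx.
  - by move=> n w _; rewrite mule_ge0// lee_fin.
  - move=> n; apply: emeasurable_funM => //; apply/measurable_EFinP.
    exact: measurableT_comp.
  apply: congr_lim; apply/funext => n.
  transitivity (\int[P]_w (\sum_(y \in range (h n))
      (y%:E * (W w * (\1_(h n @^-1` [set y]) (X w) : R)%:E)))).
    apply: eq_integral => w _.
    rewrite {1}(fimfunE (h n)) -fsumEFin// ge0_mule_fsumr; last first.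
      by move=> y; exact: nnfun_muleindic_ge0.
    by apply: eq_fsbigr => y _; rewrite EFinM muleCA.
  rewrite ge0_integral_fsum//.
  - apply: eq_fsbigr => y; rewrite inE => -[x _ <-].
    rewrite ge0_integralZl//.
    + exact: emeasurable_funM.
    + by move=> w _; rewrite mule_ge0// lee_fin.
    + by rewrite lee_fin.
  - by move=> y; apply: measurable_funeM; exact: emeasurable_funM.
  - move=> y w _; rewrite muleCA mule_ge0// -EFinM.
    exact: nnfun_muleindic_ge0.
rewrite main// main//; apply: congr_lim; apply/funext => n.
apply: eq_fsbigr => y _; rewrite E12//.
Qed.

End IntegralMulComp.

(** Testing initial segments is enough: a subfamily is recovered by taking [E j] to be the full set
    at the other indices. *)
Definition indep_seq (R : realType) (d : measure_display) (T : measurableType d)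
    (P : probability T R) (X : nat -> T -> R) : Prop :=
  forall (s : nat) (E : nat -> set R), (forall j, measurable (E j)) ->
  P (\bigcap_(j in `I_s) (X j @^-1` E j)) =
  (\prod_(j < s) P (X j @^-1` E j))%E.

Section IndependentProduct.
Variables (R : realType) (d : measure_display) (T : measurableType d).
Variables (P : probability T R) (X : nat -> T -> R).
Hypotheses (mX : forall j, measurable_fun setT (X j)) (indepX : indep_seq P X).

Local Open Scope ereal_scope.

Let measurable_preX j E : measurable E -> measurable (X j @^-1` E).
Proof. by move=> mE; rewrite -[_ @^-1` _]setTI; exact: mX. Qed.

Let integral_indicX j E : measurable E ->
  \int[P]_w (\1_E (X j w) : R)%:E = P (X j @^-1` E).
Proof.
move=> mE; have mXE := measurable_preX j mE.
by rewrite -[X j @^-1` E in RHS]setIT -integral_indic.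
Qed.

(* Indicators are replaced by the F j one coordinate at a time. *)
Lemma integral_prod_indep (s : nat) (F : nat -> R -> R) :
  (forall j, measurable_fun setT (F j)) -> (forall j x, 0 <= F j x)%R ->
  (forall j, \int[P]_w (F j (X j w))%:E \is a fin_num) ->
  \int[P]_w ((\prod_(j < s) F j (X j w))%R)%:E =
  \prod_(j < s) \int[P]_w (F j (X j w))%:E.
Proof.
(* Induction on m, the number of coordinates already allowed to be arbitrary; those from m on still
   carry indicators. For m = 0 the claim is independence itself. *)
suff gen m : (m <= s)%N -> forall F : nat -> R -> R,
    (forall j, measurable_fun setT (F j)) -> (forall j x, 0 <= F j x)%R ->
    (forall j, \int[P]_w (F j (X j w))%:E \is a fin_num) ->
    (forall j, exists2 E, measurable E & (m <= j < s)%N -> F j = \1_E) ->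
    \int[P]_w ((\prod_(j < s) F j (X j w))%R)%:E =
    \prod_(j < s) \int[P]_w (F j (X j w))%:E.
  move=> mF F0 Ffin; apply: (gen s) => // j; exists setT => // /andP[sj js].
  by move: (leq_ltn_trans sj js); rewrite ltnn.
elim: m => [_|m IH ms] {}F mF F0 Ffin FE.
  have /choice[E HE] : forall j, exists E : set R,
      measurable E /\ ((j < s)%N -> F j = \1_E).
    by move=> j; have [E mE FjE] := FE j; exists E.
  under [RHS]eq_bigr => j _.
    rewrite (HE j).2// integral_indicX; last exact: (HE j).1.
    over.
  rewrite -indepX; last by move=> j; exact: (HE j).1.
  set A := \bigcap_(j in _) _.
  have mA : measurable A.
    by apply: bigcap_measurableType => j _; apply: measurable_preX; exact: (HE j).1.
  rewrite -[A in RHS]setIT -integral_indic//.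
  apply: eq_integral => w _; congr (_%:E).
  rewrite indicE; have [wE|wE] := boolP (w \in _).
    rewrite big1// => j _; rewrite (HE j).2// indicE mem_set//.
    by move/set_mem: wE; apply => /=.
  move: wE; rewrite notin_setE -existsNE => -[j /not_implyP[/= js wj]].
  rewrite (bigD1 (Ordinal js))//= (HE j).2// indicE.
  by rewrite memNset// mul0r.
pose i := Ordinal ms.
rewrite (bigD1 i)//=.
set c := \prod_(j < s | j != i) _.
have c0 : 0 <= c by apply: prode_ge0 => j _; apply: integral_ge0 => w _;
  rewrite lee_fin.
have cf : c \is a fin_num by apply: prode_fin_num.
pose W w := (\prod_(j < s | j != i) F j (X j w))%R.
have mFX j : measurable_fun setT (fun w => F j (X j w)).
  exact: measurableT_comp.
rewrite muleC -ge0_integralZl//; first last.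
- by move=> w _; rewrite lee_fin.
- exact/measurable_EFinP.
transitivity (\int[P]_w ((W w)%:E * (F m (X m w))%:E)).
  by apply: eq_integral => w _; rewrite (bigD1 i)//= mulrC EFinM.
(* Coordinate m is freed by comparing the weight [W], the product of the other factors, with the
   constant weight [c]. It then suffices to test indicators at m, and there the induction hypothesis
   applies to [F']. *)
apply: (@eq_integral_mul_comp _ _ _ P (EFin \o W) (cst c) (X m) (X m)
  (EFin \o F m)) => //.
- apply/measurable_EFinP; rewrite /W; under eq_fun do rewrite big_mkcond/=.
  by apply: measurable_prod => j _; case: (j != i).
- by move=> w; rewrite lee_fin; apply: prodr_ge0.
- move=> E mE /=.
  pose F' j := if j == m then \1_E else F j.
  have F'i w : F' i (X i w) = \1_E (X m w) by rewrite /F' eqxx.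
  have F'm (j : 'I_s) : j != i -> F' j = F j.
    by rewrite -val_eqE /F' => /negbTE/= ->.
  have mF' j : measurable_fun setT (F' j).
    by rewrite /F'; case: ifP => // _; exact: measurable_indic.
  have F'0 j x : (0 <= F' j x)%R by rewrite /F'; case: ifP.
  have F'fin j : \int[P]_w (F' j (X j w))%:E \is a fin_num.
    rewrite /F'; case: ifP => // _; rewrite integral_indicX//.
    by apply: fin_num_measure; exact: measurable_preX.
  have F'E j : exists2 E, measurable E & (m <= j < s)%N -> F' j = \1_E.
    have [->|jm] := eqVneq j m; first by exists E; rewrite // /F' eqxx.
    have [E' mE' FE'] := FE j; exists E' => // /andP[mj js].
    by rewrite /F' (negbTE jm) FE'// ltn_neqAle eq_sym jm mj.
  have := IH (ltnW ms) F' mF' F'0 F'fin F'E.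
  rewrite [in RHS](bigD1 i)//=.
  have -> : \int[P]_w (\prod_(j < s) F' j (X j w))%:E =
      \int[P]_w ((W w)%:E * (\1_E (X m w) : R)%:E).
    apply: eq_integral => w _; rewrite (bigD1 i)//= F'i mulrC EFinM.
    by congr (_%:E * _); rewrite /W; apply: eq_bigr => j ji; rewrite F'm.
  have -> : \prod_(j < s | j != i) \int[P]_w (F' j (X j w))%:E = c.
    by rewrite /c; apply: eq_bigr => j ji; rewrite F'm.
  have -> : \int[P]_w (F' m (X m w))%:E = \int[P]_w (\1_E (X m w) : R)%:E.
    by apply: eq_integral => w _; rewrite -F'i.
  move=> IHE; rewrite IHE muleC ge0_integralZl//.
  by apply/measurable_EFinP; apply: measurableT_comp => //; exact: measurable_indic.
- exact/measurable_EFinP.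
- by move=> x; rewrite lee_fin.
Qed.
End IndependentProduct.

(** * Exponential tail bounds for sample means *)

Lemma lee_prod_ord (R : realDomainType) (n : nat) (f g : 'I_n -> \bar R) :
  (forall i, 0 <= f i)%E -> (forall i, f i <= g i)%E ->
  (\prod_(i < n) f i <= \prod_(i < n) g i)%E.
Proof.
move=> f0 fg.
suff : (0 <= \prod_(i < n) f i /\ \prod_(i < n) f i <= \prod_(i < n) g i)%E by case.
elim/big_ind2 : _ => [|x1 x2 y1 y2 [x0 x12] [y0 y12]|j _]; last by split.
  by split; [exact: lee01|exact: lexx].
by split; [exact: mule_ge0|exact: lee_pmul].
Qed.

Section Hoeffding.
Variables (R : realType) (d : measure_display) (T : measurableType d).
Variables (P : probability T R).

(** By convexity, x being the combination of b and 0 with weight x / b on b. The bound is affine in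
    x, so its expectation depends on the mean only. *)
Lemma expR_le_chord (b h x : R) : 0 < b -> 0 <= x <= b ->
  expR (h * x) <= 1 + x * ((expR (h * b) - 1) / b).
Proof.
move=> b0 /andP[x0 xb].
have t0 : 0 <= x / b by rewrite divr_ge0// ltW.
have t1 : x / b <= 1 by rewrite ler_pdivrMr// mul1r.
have := convex_expR (Itv01 t0 t1) (h * b) 0.
rewrite !convRE/= /unstable.onem mulr0 addr0 expR0 mulr1.
have -> : x / b * (h * b) = h * x by field; rewrite gt_eqF.
move/le_trans; apply; rewrite le_eqVlt; apply/orP; left; apply/eqP.
by field; rewrite gt_eqF.
Qed.

(** Integrating the chord bound gives the moment generating function, at h b, of a Bernoulli
    variable of parameter mu / b, to which [bernoulli_mgf_le] applies. *)
Lemma bounded_mgf_le (Y : T -> R) (mu b h : R) :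
  measurable_fun setT Y -> 0 < b -> (forall w, 0 <= Y w <= b) ->
  ('E_P[Y] = mu%:E)%E -> 0 <= h ->
  (\int[P]_w (expR (h * Y w))%:E <= (expR (h * mu + (h * b) ^+ 2 / 8))%:E)%E.
Proof.
move=> mY b0 Yb EY h0; set k := (expR (h * b) - 1) / b.
have k0 : 0 <= k by rewrite divr_ge0 ?(ltW b0)//
  subr_ge0 -expR0 ler_expR mulr_ge0// ltW.
have Y0 w : 0 <= Y w by case/andP: (Yb w).
have mu0 : 0 <= mu by rewrite -lee_fin -EY expectation_ge0.
have mub : mu <= b.
  rewrite -lee_fin -EY -(expectation_cst P b); apply: expectation_le => //.
    by move=> w; exact: ltW.
  by apply: aeW => w; case/andP: (Yb w).
have hmu : mu / b * (h * b) = h * mu.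
  by rewrite [h * b]mulrC mulrA divfK ?gt_eqF// mulrC.
have /bernoulli_mgf_le/(_ _ (mulr_ge0 h0 (ltW b0))) : 0 <= mu / b <= 1.
  by rewrite divr_ge0 ?(ltW b0)//= ler_pdivrMr// mul1r.
rewrite hmu -lee_fin; apply: le_trans.
have -> : 1 - mu / b + mu / b * expR (h * b) = 1 + k * mu.
  by rewrite /k; field; rewrite gt_eqF.
apply: (@le_trans _ _ (\int[P]_w ((1 : R)%:E + k%:E * (Y w)%:E))%E).
  apply: ge0_le_integral => //.
  - by apply/measurable_EFinP; apply: measurableT_comp => //; exact: measurable_funM.
  - by apply: emeasurable_funD => //; apply: measurable_funeM; exact/measurable_EFinP.
  - by move=> w _; rewrite -EFinM -EFinD lee_fin [k * _]mulrC; exact: expR_le_chord.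
rewrite ge0_integralD//.
- rewrite integral_cst// mul1e [X in (X + _)%E](_ : _ = 1%E);
  last exact: probability_setT.
  rewrite ge0_integralZl//.
  + by move: EY; rewrite unlock => ->; rewrite -EFinM -EFinD.
  + exact/measurable_EFinP.
  + by move=> w _; rewrite lee_fin.
- by move=> w _; rewrite -EFinM lee_fin mulr_ge0.
- by apply: measurable_funeM; exact/measurable_EFinP.
Qed.

Section Tail.
Variables (X : nat -> T -> R) (mu b : R).
Hypotheses (mX : forall j, measurable_fun setT (X j)) (indepX : indep_seq P X).
Hypotheses (b_gt0 : 0 < b) (Xb : forall j w, 0 <= X j w <= b).
Hypothesis EX : forall j, ('E_P[X j] = mu%:E)%E.

Definition mean_exceeds (s : nat) (x : R) : set T :=
  [set w | x <= (\sum_(j < s) X j w) / s%:R].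

Lemma measurable_mean_exceeds s x : measurable (mean_exceeds s x).
Proof.
rewrite -[mean_exceeds s x]setTI.
have mS : measurable_fun setT (fun w => (\sum_(j < s) X j w) / s%:R).
  by apply: measurable_funM => //; exact: measurable_sum.
rewrite [mean_exceeds s x](_ : _ = (fun w => (\sum_(j < s) X j w) / s%:R)
    @^-1` `[x, +oo[).
  exact: mS.
by apply/seteqP; split => w /=; rewrite in_itv/= andbT.
Qed.

Lemma hoeffding s eps : 0 <= eps ->
  (P (mean_exceeds s (mu + eps)) <= (expR (- (2 * s%:R * eps ^+ 2 / b ^+ 2)))%:E)%E.
Proof.
(* For an empty sample the right-hand side is exp 0 = 1. *)
move=> eps0; case: s => [|s].
  by rewrite mulr0 !mul0r oppr0 expR0 probability_le1//;
    exact: measurable_mean_exceeds.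
(* The minimizer of the Chernoff exponent s (h^2 b^2 / 8 - h eps). *)
pose h := 4 * eps / b ^+ 2.
have b20 : 0 < b ^+ 2 by rewrite exprn_gt0.
have h0 : 0 <= h by rewrite divr_ge0 ?mulr_ge0// ltW.
pose a := h * (s.+1%:R * (mu + eps)).
set A := mean_exceeds _ _.
have mA : measurable A by exact: measurable_mean_exceeds.
have mg : measurable_fun setT (fun x : R => expR (h * x)).
  by apply: measurableT_comp => //; exact: measurable_funM.
have mgf j := bounded_mgf_le (mX j) b_gt0 (Xb j) (EX j) h0.
have g0 j : (0 <= \int[P]_w (expR (h * X j w))%:E)%E.
  by apply: integral_ge0 => w _; rewrite lee_fin expR_ge0.
have gfin j : (\int[P]_w (expR (h * X j w))%:E)%E \is a fin_num.
  by rewrite ge0_fin_numE//; apply: le_lt_trans (mgf j) _; rewrite ltry.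
have mprod : measurable_fun setT (fun w => \prod_(j < s.+1) expR (h * X j w)).
  by apply: measurable_prod => j _; exact: (measurableT_comp mg).
rewrite -[A in leLHS]setIT -integral_indic//.
(* Markov's inequality for the exponential of h times the sum; independence then factors the
   integral. *)
apply: (@le_trans _ _ (\int[P]_w ((expR (- a))%:E * (\prod_(j < s.+1)
  expR (h * X j w))%:E))%E).
  apply: ge0_le_integral => //.
  - by apply/measurable_EFinP; exact: measurable_indic.
  - by apply: measurable_funeM; exact/measurable_EFinP.
  - move=> w _; rewrite -EFinM lee_fin indicE.
    have [/set_mem Aw|_] := boolP (w \in A); last first.
      by rewrite mulr_ge0 ?expR_ge0// prodr_ge0// => j _; rewrite expR_ge0.
    rewrite -expR_sum -expRD -expR0 ler_expR -mulr_sumr /a addrC -mulrBr mulr_ge0//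
      subr_ge0.
    by move: Aw; rewrite /A /mean_exceeds/= ler_pdivlMr// mulrC.
rewrite ge0_integralZl//; last 2 first.
- exact/measurable_EFinP.
- by move=> w _; rewrite lee_fin prodr_ge0// => j _; rewrite expR_ge0.
rewrite (@integral_prod_indep _ _ _ P X mX indepX _ (fun _ x => expR (h * x)))//.
apply: (@le_trans _ _ ((expR (- a))%:E *
    \prod_(j < s.+1) (expR (h * mu + (h * b) ^+ 2 / 8))%:E)%E).
  rewrite lee_pmul2l ?lte_fin ?expR_gt0//.
  by apply: lee_prod_ord.
rewrite prodEFin -EFinM lee_fin big_const_ord iter_mulr_1 -expRM_natl -expRD ler_expR.
rewrite le_eqVlt; apply/orP; left; apply/eqP.
by rewrite /a /h -[_ *+ _]mulr_natl; field; rewrite gt_eqF.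
Qed.

(** The shift [i.+1] leaves out the empty sample. The event is empty for t = 0, which later makes
    the reindexing by k - u harmless. *)
Definition deviation (t : nat) : set T :=
  \big[setU/set0]_(i < t)
    mean_exceeds i.+1 (mu + b * Num.sqrt (2 * ln t%:R / i.+1%:R)).

Lemma measurable_deviation t : measurable (deviation t).
Proof. by apply: bigsetU_measurable => i _; exact: measurable_mean_exceeds. Qed.

Lemma deviation_le t : (P (deviation t) <= (t%:R ^- 2)%:E)%E.
Proof.
case: t => [|t]; first
  by rewrite /deviation big_ord0 measure0 lee_fin invr_ge0 sqr_ge0.
set l := ln (t.+1%:R : R); have l0 : 0 <= l by rewrite ln_ge0// ler1n.
apply: (le_trans (Boole_inequality P (A := fun i => mean_exceeds i.+1
  (mu + b * Num.sqrt (2 * l / i.+1%:R))) _)) => [i _|].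
  exact: measurable_mean_exceeds.
apply: (@le_trans _ _ (\sum_(i < t.+1) (t.+1%:R ^- 4)%:E)%E).
  apply: lee_sum => i _; apply: (le_trans (hoeffding _ _)).
    by rewrite mulr_ge0 ?sqrtr_ge0// ltW.
  (* The radius is such that the Hoeffding exponent equals -4 ln t whatever the sample size. *)
  rewrite lee_fin -[t.+1%:R in leRHS]lnK ?posrE//
    -/l -expRM_natl -expRN ler_expR lerN2.
  rewrite exprMn sqr_sqrtr ?divr_ge0 ?mulr_ge0//.
  rewrite le_eqVlt; apply/orP; left; apply/eqP.
  by field; rewrite gt_eqF//= pnatr_eq0.
rewrite sumEFin lee_fin big_const_ord iter_addr_0 -[_ *+ _]mulr_natl.
rewrite [leLHS](_ : _ = t.+1%:R ^- 3); last by field; rewrite nat1r pnatr_eq0.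
by rewrite lef_pV2 ?posrE ?exprn_gt0// ler_weXn2l// ler1n.
Qed.

End Tail.
End Hoeffding.

Lemma indep_seq_comp (R : realType) (d : measure_display) (T : measurableType d)
    (P : probability T R) (X : nat -> T -> R) (f : R -> R) :
  measurable_fun setT f -> indep_seq P X -> indep_seq P (fun j => f \o X j).
Proof.
move=> mf iX s E mE; apply: (iX s (fun j => f @^-1` E j)) => j.
by rewrite -[_ @^-1` _]setTI; exact: mf.
Qed.

(** Independence is applied on the image of an initial segment under [f]; the left inverse [g]
    carries events indexed by integers over to [J]. *)
Lemma mutually_independent_seq (R : realType) (d : measure_display)
    (T : measurableType d) (P : probability T R) (J : choiceType)
    (X : J -> {RV P >-> R}) (f : nat -> J) (g : J -> nat) :
  cancel f g -> mutually_independent X -> indep_seq P (fun j => X (f j)).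
Proof.
move=> fK iX s E mE; pose S : {fset J} := [fset f j | j in iota 0 s]%fset.
have := iX S (E \o g) (fun j _ => mE (g j)).
rewrite big_imfset/=; last by move=> x y _ _; exact: can_inj fK x y.
rewrite undup_id ?iota_uniq//
  -[X in iota 0 X]subn0 -/(index_iota 0 s) big_mkord => XE.
transitivity (P (\bigcap_(j in [set` S]) X j @^-1` (E \o g) j)).
  congr (P _); apply/seteqP; split => w Xw j /=.
    by case/imfsetP => i /= /[!mem_iota]/= /[!add0n] si ->; rewrite fK; exact: Xw.
  move=> js; have := Xw (f j); rewrite /= fK; apply.
  by apply/imfsetP; exists j; rewrite //= mem_iota.
by rewrite XE; apply: eq_bigr => j _; rewrite /= fK.
Qed.

(** * Suboptimal choices along one trajectory *)

(** Passes from subtasks k to ages k - u. Truncated subtraction sends every k <= u to 0, where f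
    vanishes, and is injective beyond u. *)
Lemma sum_nat_subn_le (f : nat -> nat) (u lo hi : nat) : f 0%N = 0%N ->
  (\sum_(lo <= k < hi) f (k - u) <= \sum_(0 <= t < hi) f t)%N.
Proof.
move=> f0; have [hilo|lohi] := leqP hi lo; first by rewrite big_geq.
apply: (@leq_trans (\sum_(0 <= k < hi) f (k - u))).
  by rewrite [leqRHS](@big_cat_nat _ _ _ lo)//= ?leq_addl// ltnW.
have -> : (\sum_(0 <= k < hi) f (k - u) = \sum_(0 <= t < hi - u) f t)%N.
  elim: hi {lohi} => [|k IH]; first by rewrite sub0n !big_geq.
  rewrite big_nat_recr//= IH; have [uk|ku] := leqP u k.
    by rewrite subSn// [RHS]big_nat_recr.
  have -> : (k - u = 0)%N by lia.
  by have -> : (k.+1 - u = 0)%N by [lia]; rewrite f0 !big_geq.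
by rewrite [leqRHS](@big_cat_nat _ _ _ (hi - u))//= ?leq_addr// leq_subr.
Qed.

Lemma exists_epoch (B : nat) (Kend : nat -> nat) (k : nat) :
  epoch_ends B Kend -> (1 <= k <= Kend B)%N -> exists b, in_epoch B Kend b k.
Proof.
move=> [K0 Kinc] /andP[k1 kK].
have exb : exists b, (k <= Kend b)%N by exists B.
case: (ex_minnP exb) => b kb bmin; exists b.
have bB : (b <= B)%N by exact: bmin.
case: b kb bmin bB => [|b] kb bmin bB; first by move: kb k1; rewrite K0; lia.
rewrite /in_epoch/= bB kb andbT/= ltnNge; apply/negP => /bmin.
by rewrite ltnn.
Qed.

Lemma Kend_le (B : nat) (Kend : nat -> nat) (b b' : nat) :
  epoch_ends B Kend -> (b <= b' <= B)%N -> (Kend b <= Kend b')%N.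
Proof.
move=> [_ Kinc]; elim: b' => [|b' IH] /andP[bb' b'B].
  by move: bb'; rewrite leqn0 => /eqP ->.
move: bb'; rewrite leq_eqVlt => /predU1P[->//|bb'].
by apply: leq_trans (IH _) (ltnW (Kinc _ b'B)); rewrite -ltnS bb' ltnW.
Qed.

Lemma in_epoch_le (B : nat) (Kend : nat -> nat) (b k : nat) :
  epoch_ends B Kend -> in_epoch B Kend b k -> (1 <= k <= Kend B)%N.
Proof.
move=> KB /andP[/andP[b1 bB] /andP[bk kb]]; rewrite (leq_ltn_trans _ bk)//.
by rewrite (leq_trans kb)// (Kend_le KB)// bB leqnn.
Qed.

Lemma mem_deviation (R : realType) (d : measure_display) (T : measurableType d)
    (X : nat -> T -> R) (mu b : R)
    (s t : nat) (w : T) : (0 < s <= t)%N ->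
  mu + b * Num.sqrt (2 * ln t%:R / s%:R) <= (\sum_(j < s) X j w) / s%:R ->
  deviation X mu b t w.
Proof.
case: s => [//|s] /= st h; rewrite /deviation.
rewrite -(bigcup_mkord _ (fun i => mean_exceeds X i.+1
  (mu + b * Num.sqrt (2 * ln t%:R / i.+1%:R)))).
by exists s.
Qed.

(** * Counting the choices of one suboptimal station *)

Section Counting.
Variables (BS : finType) (R : realType) (d : measure_display) (T : measurableType d).
Variables (Z : BS -> nat -> T -> R) (a : nat -> T -> BS) (beta : R).
Variables (B : nat) (Kend : nat -> nat) (A : nat -> {set BS}) (u v : BS -> nat).
Hypotheses (beta_gt0 : 0 < beta) (Kends : epoch_ends B Kend).
Hypotheses (uv : lifespans B Kend A u v) (ucb : vucb1 Z a beta B Kend A u).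
Variable w : T.

Lemma usesS n k : (0 < k)%N -> uses a n k.+1 w = (uses a n k w + (a k w == n))%N.
Proof. by move=> k0; rewrite /uses big_nat_recr. Qed.

(** Whatever the policy, the observations made from n are consumed in order. The empirical mean is
    thus a partial mean of a fixed sequence, and only its length depends on the choices. *)
Lemma sum_observed n k :
  \sum_(1 <= i < k | a i w == n) observed Z a i w = \sum_(j < uses a n k w) Z n j w.
Proof.
elim: k => [|[|k] IH]; first by rewrite /uses !big_geq// big_ord0.
  by rewrite /uses !big_geq// big_ord0.
rewrite usesS// big_mkcond big_nat_recr//= -big_mkcond IH.
case: eqP => [<-|_]; last by rewrite addr0 addn0.
by rewrite addn1 big_ord_recr.
Qed.

Lemma choice_available b k : in_epoch B Kend b k -> a k w \in A b.
Proof.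
move=> bk; have := ucb w bk; case: ifP => _; first by rewrite inE => /andP[].
by rewrite inE => /andP[].
Qed.

Lemma choice_appeared k : (1 <= k <= Kend B)%N -> (u (a k w) <= k)%N.
Proof.
move=> kK; have [b bk] := exists_epoch Kends kK.
by have := choice_available bk; rewrite (uv.2 _ _ _ bk) => /andP[].
Qed.

Lemma uses_le n k : (k <= (Kend B).+1)%N -> (uses a n k w <= k - u n)%N.
Proof.
elim: k => [|[|k] IH] kK; [by rewrite /uses big_geq..|].
rewrite usesS//; have := IH (ltnW kK).
case: eqP => [an|_]; last by lia.
by have := @choice_appeared k.+1 kK; rewrite an; lia.
Qed.

(** Every counted choice is itself a use. The bound by [uses] carries the induction: a choice
    counted at i has fewer than l earlier uses, so the count stays at most l. *)
Lemma sum_few_uses_le n l k :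
  (\sum_(1 <= i < k) ((a i w == n) && (uses a n i w < l)) <= minn l (uses a n k w))%N.
Proof.
elim: k => [|[|k] IH]; [by rewrite big_geq..|].
rewrite big_nat_recr//= (usesS n (ltn0Sn k)); move: IH.
by case: eqP => _ /=; [case: ltnP|]; lia.
Qed.

(* If neither mean deviates, the index of m lies below z m and that of n above
   z n minus two confidence radii, which exceeds z m once n was used l times. *)
Lemma suboptimal_choice (z : BS -> R) (gap0 : R) (b k l : nat) (m n : BS) :
  in_epoch B Kend b k -> m \in A b -> a k w = n -> 0 < gap0 ->
  gap0 <= (z n - z m) / beta -> (0 < l)%N ->
  8 * ln (Kend B)%:R <= l%:R * gap0 ^+ 2 -> (l <= uses a n k w)%N ->
  deviation (Z m) (z m) beta (k - u m) w \/
  deviation (fun j w => beta - Z n j w) (beta - z n) beta (k - u n) w.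
Proof.
move=> bk mA akn gap0_gt0 gapn l0 lK ln_uses.
have /andP[k1 kK] := in_epoch_le Kends bk.
(* An initial trial is excluded, since n has already been used l > 0 times; hence the choice
   minimizes the index and all available stations have been used. *)
have := ucb w bk; case: ifPn => [_|].
  by rewrite akn inE => /andP[_ /eqP n0]; move: l0 ln_uses; rewrite n0; lia.
rewrite negbK => /eqP unused0.
have used n' : n' \in A b -> (0 < uses a n' k w)%N.
  move=> n'A; rewrite lt0n; apply/negP => n'0.
  by have := finset.in_set0 n'; rewrite -unused0 inE n'A n'0.
rewrite akn inE => /andP[nA /forallP/(_ m)];
  rewrite mA/= /vucb1_index /avg_obs !sum_observed.
have um := used _ mA; have un := used _ nA.
have kK' : (k <= (Kend B).+1)%N by exact: leq_trans kK _.
have umk := uses_le m kK'; have unk := uses_le n kK'.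
move: um un umk unk ln_uses; set sm := uses a m k w; set sn := uses a n k w.
move=> um un umk unk ln_uses.
move=> idx; apply: contrapT => /not_orP[devm devn].
have {devm} hm : (\sum_(j < sm) Z m j w) / sm%:R <
    z m + beta * Num.sqrt (2 * ln (k - u m)%:R / sm%:R).
  by rewrite ltNge; apply/negP => h; apply: devm; apply: mem_deviation h; rewrite um.
have {devn} hn : z n - beta * Num.sqrt (2 * ln (k - u n)%:R / sn%:R) <
    (\sum_(j < sn) Z n j w) / sn%:R.
  (* The mean of the reflected observations beta - Z n is beta minus the mean of Z n, so a low mean
     of n is a high reflected mean. *)
  rewrite ltNge; apply/negP => h; apply: devn; apply: (@mem_deviation _ _ _ _ _ _ sn).
    by rewrite un.
  rewrite sumrB sumr_const card_ord mulrBl -[beta *+ _]mulr_natr mulfK ?pnatr_eq0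
    -?lt0n//.
  by move: h; lra.
(* Squared, this reads 8 ln (k - u n) <= sn gap0^2, whence the constant 8 in the choice of l. *)
have radius : 2 * Num.sqrt (2 * ln (k - u n)%:R / sn%:R) <= gap0.
  have sn0 : 0 < sn%:R :> R by rewrite ltr0n.
  have kun : (0 < k - u n)%N by exact: leq_trans un unk.
  have ln0 : 0 <= ln (k - u n)%:R :> R by rewrite ln_ge0// ler1n.
  rewrite -(@ler_pXn2r _ 2)// ?nnegrE ?mulr_ge0 ?sqrtr_ge0// ?(ltW gap0_gt0)//.
  rewrite exprMn sqr_sqrtr ?divr_ge0 ?mulr_ge0 ?(ltW sn0)//.
  rewrite mulrA ler_pdivrMr//.
  have lnK : ln (k - u n)%:R <= ln (Kend B)%:R :> R.
    rewrite ler_ln ?posrE ?ltr0n ?(leq_trans k1 kK)// ler_nat.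
    exact: leq_trans (leq_subr _ _) kK.
  have : l%:R * gap0 ^+ 2 <= sn%:R * gap0 ^+ 2.
    by rewrite ler_wpM2r ?sqr_ge0// ler_nat.
  by move: lK lnK; lra.
have : beta * gap0 <= z n - z m by move: gapn; rewrite ler_pdivlMr// mulrC.
have : beta * (2 * Num.sqrt (2 * ln (k - u n)%:R / sn%:R)) <= beta * gap0.
  by rewrite ler_pM2l.
by move: idx hm hn; lra.
Qed.

(** At most l choices of n are made with fewer than l earlier uses; each other choice in the epoch
    falls in a deviation event at the age of m or of n. The sums on the right involve the
    observations only, not the policy. *)
Lemma count_choice_le (z : BS -> R) (gap0 : R) (b l : nat) (m n : BS) :
  (1 <= b <= B)%N -> m \in A b -> 0 < gap0 ->
  gap0 <= (z n - z m) / beta -> (0 < l)%N ->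
  8 * ln (Kend B)%:R <= l%:R * gap0 ^+ 2 ->
  (\sum_((Kend b.-1).+1 <= k < (Kend b).+1) (a k w == n) <=
   l + \sum_(0 <= t < (Kend B).+1) (w \in deviation (Z m) (z m) beta t)
     + \sum_(0 <= t < (Kend B).+1)
         (w \in deviation (fun j w => beta - Z n j w)%R (beta - z n)%R beta t))%N.
Proof.
move=> bB mA gap0_gt0 gapn l0 lK.
set Dm := deviation _ _ _; set Dn := deviation _ _ _.
have D0 X mu : (w \in deviation X mu beta 0) = 0%N :> nat.
  by rewrite /deviation big_ord0 memNset.
have KbB : (Kend b <= Kend B)%N by case/andP: bB => _ bB;
  rewrite (Kend_le Kends)// bB leqnn.
have ext (f : nat -> nat) : (\sum_(0 <= t < (Kend b).+1) f t <=
    \sum_(0 <= t < (Kend B).+1) f t)%N.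
  by rewrite [leqRHS](@big_cat_nat _ _ _ (Kend b).+1)//= leq_addr.
apply: (@leq_trans (\sum_((Kend b.-1).+1 <= k < (Kend b).+1)
    (((a k w == n) && (uses a n k w < l)) + (w \in Dm (k - u m))
     + (w \in Dn (k - u n))))%N).
  rewrite big_nat_cond [leqRHS]big_nat_cond; apply: leq_sum => k.
  rewrite andbT ltnS => bk; case: eqP => //= akn.
  have [ul|lu] := ltnP (uses a n k w) l; first by [].
  rewrite add0n.
  have ibk : in_epoch B Kend b k by rewrite /in_epoch bB.
  by have [h|h] := suboptimal_choice ibk mA akn gap0_gt0 gapn l0 lK lu;
    rewrite (mem_set h); lia.
rewrite !big_split/= !leq_add//.
- apply: leq_trans (geq_minl l (uses a n (Kend b).+1 w)).
  apply: leq_trans (sum_few_uses_le _ _ _).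
  rewrite [leqRHS](@big_cat_nat _ _ _ (Kend b.-1).+1)//= ?leq_addl//.
  by rewrite ltnS (Kend_le Kends)// leq_pred; case/andP: bB.
- apply: leq_trans (ext _);
  apply: (@sum_nat_subn_le (fun t => nat_of_bool (w \in Dm t))); exact: D0.
- apply: leq_trans (ext _);
  apply: (@sum_nat_subn_le (fun t => nat_of_bool (w \in Dn t))); exact: D0.
Qed.

End Counting.

(** * Expectations *)

Lemma sum_invsqr_le (R : realFieldType) (n : nat) :
  \sum_(0 <= t < n) (t%:R : R) ^- 2 <= 2.
Proof.
case: n => [|[|n]]; first by rewrite big_geq.
  by rewrite big_nat1 expr0n/= invr0.
(* The term t = 0 is 0 by the convention on inverses. The sharper bound passes through the induction
   because 1/x - 1/(x+1) - 1/(x+1)^2 = 1/(x (x+1)^2). *)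
suff : \sum_(0 <= t < n.+2) (t%:R : R) ^- 2 <= 2 - n.+1%:R^-1.
  by move=> /le_trans; apply; rewrite lerBlDr lerDl invr_ge0.
elim: n => [|n IH]; first by rewrite !big_nat_recr//= big_geq// expr0n/= invr0; lra.
rewrite big_nat_recr//=; apply: (le_trans (lerD IH (lexx _))).
have n0 : 0 < n.+1%:R :> R by rewrite ltr0n.
rewrite -[n.+2%:R]natr1; set x : R := n.+1%:R in n0 *.
have x1 : 0 < x + 1 by rewrite addr_gt0.
rewrite -subr_ge0 [X in 0 <= X](_ : _ = (x * (x + 1) ^+ 2)^-1).
  by rewrite invr_ge0 mulr_ge0 ?sqr_ge0// ltW.
by field; rewrite !gt_eqF.
Qed.

Lemma measurable_fin_comp (R : realType) (d : measure_display) (T : measurableType d)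
    (F : finType) (f : F -> R) (alpha : T -> F) :
  (forall n, measurable [set w | alpha w = n]) -> measurable_fun setT (f \o alpha).
Proof.
move=> malpha.
rewrite (_ : f \o alpha = fun w => \sum_(n : F) f n * \1_[set w | alpha w = n] w).
  by apply: measurable_sum => n; apply: measurable_funM.
apply/funext => w; rewrite (bigD1 (alpha w))//= indicE mem_set//= mulr1 big1
  ?addr0// => n na.
by rewrite indicE memNset ?mulr0//= => an; rewrite an eqxx in na.
Qed.

(** Both Y and b - Y are nonnegative, so additivity of nonnegative integrals suffices and
    integrability need not be discussed. *)
Lemma expectation_complement (R : realType) (d : measure_display)
    (T : measurableType d) (P : probability T R) (Y : T -> R) (mu b : R) :
  measurable_fun setT Y -> (forall w, 0 <= Y w <= b) -> ('E_P[Y] = mu%:E)%E ->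
  ('E_P[fun w => (b - Y w)%R] = (b - mu)%:E)%E.
Proof.
move=> mY Yb EY.
have EbY : ('E_P[fun w => (b - Y w)%R] + 'E_P[Y] = b%:E)%E.
  rewrite -(expectation_cst P b) unlock -ge0_integralD//.
  - by apply: eq_integral => w _; rewrite -EFinD subrK.
  - by move=> w _; rewrite lee_fin subr_ge0; case/andP: (Yb w).
  - by apply/measurable_EFinP; exact: measurable_funB.
  - by move=> w _; rewrite lee_fin; case/andP: (Yb w).
  - exact/measurable_EFinP.
by rewrite EFinB -EbY EY addeK.
Qed.

Lemma integral_count_le (R : realType) (d : measure_display) (T : measurableType d)
    (P : probability T R) (D : nat -> set T) (n : nat) :
  (forall t, measurable (D t)) -> (forall t, P (D t) <= ((t%:R : R) ^- 2)%:E)%E ->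
  (\int[P]_w ((\sum_(0 <= t < n) (w \in D t))%N%:R : R)%:E <= 2%:E)%E.
Proof.
move=> mD PD.
have -> : (\int[P]_w ((\sum_(0 <= t < n) (w \in D t))%N%:R : R)%:E =
    \int[P]_w \sum_(0 <= t < n) (\1_(D t) w : R)%:E)%E.
  apply: eq_integral => w _; rewrite sumEFin natr_sum.
  by congr (_%:E); apply: eq_bigr => t _; rewrite indicE.
rewrite ge0_integral_sum//; last first.
  by move=> t; apply/measurable_EFinP; exact: measurable_indic.
apply: (@le_trans _ _ (\sum_(0 <= t < n) ((t%:R : R) ^- 2)%:E)%E).
  apply: lee_sum => t _; apply: le_trans (PD t).
  by rewrite -[D t in leRHS]setIT -integral_indic.
by rewrite sumEFin lee_fin sum_invsqr_le.
Qed.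

(** * Handovers and suboptimal choices *)

Section SuboptimalCounts.
Variables (BS : finType) (T : Type) (a : nat -> T -> BS) (astar : nat -> BS).
Variables (B : nat) (Kend : nat -> nat).

Definition suboptimal_count (b : nat) (w : T) : nat :=
  (\sum_((Kend b.-1).+1 <= k < (Kend b).+1) (a k w != astar b))%N.

(** The 1 pays for the handover into the epoch. Inside it, two different consecutive choices cannot
    both be optimal, and each subtask belongs to at most two consecutive pairs. *)
Lemma epoch_handovers_le b w : (Kend b.-1 < Kend b)%N ->
  (\sum_((Kend b.-1).+1 <= k < (Kend b).+1) (a k w != a k.-1 w) <=
   1 + 2 * suboptimal_count b w)%N.
Proof.
move=> Kb; rewrite big_ltn ?ltnS//; apply: leq_add; first by case: (_ != _).
pose sub k := nat_of_bool (a k w != astar b).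
apply: (@leq_trans (\sum_((Kend b.-1).+2 <= k < (Kend b).+1) (sub k + sub k.-1))%N).
  apply: leq_sum => k _; rewrite /sub.
  by case: eqP => //= aa; case: eqP => // ab; case: eqP => // ab'; case: aa;
    rewrite ab ab'.
rewrite big_split/= mul2n -addnn leq_add//.
  by rewrite /suboptimal_count [leqRHS]big_ltn ?ltnS// leq_addl.
rewrite big_add1/= /suboptimal_count.
by rewrite [leqRHS]big_nat_recr//= leq_addr.
Qed.

Lemma handovers_le w : epoch_ends B Kend ->
  (\sum_(2 <= k < (Kend B).+1) (a k w != a k.-1 w) <=
   B + 2 * \sum_(1 <= b < B.+1) suboptimal_count b w)%N.
Proof.
move=> [K0 Kinc].
(* Starting the sum at k = 1 adds a nonnegative spurious term comparing with [a 0], but makes the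
   range split exactly into epochs. *)
suff gen b : (b <= B)%N ->
    (\sum_(1 <= k < (Kend b).+1) (a k w != a k.-1 w) <=
     b + 2 * \sum_(1 <= b' < b.+1) suboptimal_count b' w)%N.
  apply: leq_trans (gen B (leqnn B)).
  have [K1|K1] := ltnP 0 (Kend B); last by rewrite big_geq// ltnS (leq_trans K1).
  by rewrite [leqRHS]big_ltn// leq_addl.
elim: b => [|b IH] bB; first by rewrite K0 big_geq.
have Kb := Kinc _ bB.
rewrite (@big_cat_nat _ _ _ (Kend b).+1)//=; last by rewrite ltnS ltnW.
rewrite [X in (_ <= _ + 2 * X)%N]big_nat_recr//=.
have := IH (ltnW bB); have := @epoch_handovers_le b.+1 w Kb => /=.
move: (suboptimal_count _ _) (bigop _ _ _) (bigop _ _ _) (bigop _ _ _) => s1 s2 s3 s4.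
lia.
Qed.

End SuboptimalCounts.

Lemma measurable_mem_natr (R : realType) (d : measure_display) (T : measurableType d)
    (D : set T) : measurable D -> measurable_fun setT (fun w => (w \in D)%:R : R).
Proof.
move=> mD; rewrite (_ : (fun w => _) = \1_D); first exact: measurable_indic.
by apply/funext => w; rewrite indicE.
Qed.

Lemma measurable_sum_nat (R : realType) (d : measure_display) (T : measurableType d)
    (lo hi : nat) (g : nat -> T -> R) :
  (forall k, (lo <= k < hi)%N -> measurable_fun setT (g k)) ->
  measurable_fun setT (fun w => \sum_(lo <= k < hi) g k w).
Proof.
move=> mg; under eq_fun do rewrite big_nat_cond big_mkcond.
apply: measurable_sum => k.
by have [kb|kb] := boolP (lo <= k < hi)%N; [exact: mg|exact: measurable_cst].
Qed.

(** * Expected counts, epoch regret and handovers *)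

Section ExpectedCounts.
Variables (BS : finType) (R : realType) (d : measure_display) (T : measurableType d).
Variables (P : probability T R) (Z : BS -> nat -> {RV P >-> R}) (z : BS -> R).
Variables (a : nat -> T -> BS) (beta gap0 : R) (astar : nat -> BS).
Variables (B : nat) (Kend : nat -> nat) (A : nat -> {set BS}) (u v : BS -> nat).
Hypotheses (beta_gt0 : 0 < beta) (gap0_gt0 : 0 < gap0) (Kends : epoch_ends B Kend).
Hypotheses (uv : lifespans B Kend A u v).
Hypothesis indepZ : mutually_independent (fun nj : BS * nat => Z nj.1 nj.2).
Hypothesis EZ : forall n j, ('E_P[Z n j] = (z n)%:E)%E.
Hypothesis Zb : forall n j w, 0 <= Z n j w <= beta.
Hypothesis best : forall b, (1 <= b <= B)%N -> argmin (A b) z = finset.set1 (astar b).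
Hypothesis gaps : forall b n, (1 <= b <= B)%N -> n \in A b -> n != astar b ->
  gap0 <= gap beta z astar n b.
Hypothesis ma : forall k n, (1 <= k <= Kend B)%N -> measurable [set w | a k w = n].
Hypothesis ucb : vucb1 (fun n j => Z n j) a beta B Kend A u.

Let indep_obs n : indep_seq P (fun j => Z n j).
Proof.
by apply: (@mutually_independent_seq _ _ _ P _ _ (pair n) snd _ indepZ) => j.
Qed.

Let measurable_choice (b k : nat) (f : BS -> R) : (1 <= b <= B)%N ->
  (Kend b.-1 < k <= Kend b)%N -> measurable_fun setT (fun w => f (a k w)).
Proof.
move=> bB bk; apply: measurable_fin_comp => n; apply: ma.
by apply: (in_epoch_le Kends (b := b)); rewrite /in_epoch bB.
Qed.

Let astar_available b : (1 <= b <= B)%N ->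
  astar b \in A b /\ forall n, n \in A b -> z (astar b) <= z n.
Proof.
move=> bB; have : astar b \in argmin (A b) z by rewrite best// inE.
by rewrite inE => /andP[sA /forallP zs]; split=> // n nA; have := zs n; rewrite nA.
Qed.

Lemma integral_choices_le (b l : nat) (n : BS) :
  (1 <= b <= B)%N -> n \in A b -> n != astar b -> (0 < l)%N ->
  8 * ln (Kend B)%:R <= l%:R * gap0 ^+ 2 ->
  (\int[P]_w ((\sum_((Kend b.-1).+1 <= k < (Kend b).+1) (a k w == n))%N%:R : R)%:E
     <= (l%:R + 4)%:E)%E.
Proof.
move=> bB nA nstar l0 lK; have [sA _] := astar_available bB.
pose Ds := deviation (fun j => Z (astar b) j : T -> R) (z (astar b)) beta.
(* Underestimating z n is overestimating beta - z n from reflected observations, which again lie in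
   [0, beta]. Each of the two families of events contributes at most 2 to the expectation, hence l +
   4. *)
pose Dn := deviation (fun j w => beta - Z n j w) (beta - z n) beta.
have mXn j : measurable_fun setT (fun w => beta - Z n j w) by exact: measurable_funB.
have mDs t : measurable (Ds t) by exact: measurable_deviation.
have mDn t : measurable (Dn t) by exact: measurable_deviation.
have PDs t : (P (Ds t) <= ((t%:R : R) ^- 2)%:E)%E by apply: deviation_le.
have PDn t : (P (Dn t) <= ((t%:R : R) ^- 2)%:E)%E.
  apply: deviation_le => //.
  - have mf : measurable_fun setT (fun x : R => beta - x) by exact: measurable_funB.
    exact: (indep_seq_comp mf (indep_obs n)).
  - by move=> j w; case/andP: (Zb n j w) => Z0 Z1; rewrite subr_ge0 Z1 lerBlDr lerDl.
  - by move=> j; exact: expectation_complement.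
pose count (D : nat -> set T) w : R := (\sum_(0 <= t < (Kend B).+1) (w \in D t))%N%:R.
have count_ge0 D w : (0 <= (count D w)%:E)%E by rewrite lee_fin.
have mcount D : (forall t, measurable (D t)) ->
    measurable_fun setT (fun w => (count D w)%:E).
  move=> mD; apply/measurable_EFinP; rewrite /count; under eq_fun do rewrite natr_sum.
  by apply: measurable_sum => t; exact: measurable_mem_natr.
apply: (@le_trans _ _ (\int[P]_w ((l%:R : R)%:E + ((count Ds w)%:E +
  (count Dn w)%:E)))%E).
  apply: ge0_le_integral => //.
  - apply/measurable_EFinP; under eq_fun do rewrite natr_sum.
    apply: measurable_sum_nat => k bk.
    exact: (measurable_choice (fun n' => (n' == n)%:R) bB bk).
  - by apply: emeasurable_funD => //; apply: emeasurable_funD; exact: mcount.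
  - move=> w _; rewrite -!EFinD lee_fin addrA -!natrD ler_nat.
    exact: (count_choice_le beta_gt0 Kends uv ucb w bB sA gap0_gt0
      (gaps bB nA nstar)).
rewrite ge0_integralD//; last 2 first.
- by move=> w _; rewrite adde_ge0.
- by apply: emeasurable_funD; exact: mcount.
rewrite (@ge0_integralD _ _ _ _ _ _ (fun w => (count Ds w)%:E)) //;
  [|exact: mcount..].
rewrite integral_cst// [X in (_ * X + _)%E](_ : _ = 1%E);
  last exact: probability_setT.
rewrite mule1 EFinD leeD2l// [4](_ : _ = 2 + 2 :> R); last by ring.
by rewrite EFinD leeD//; exact: integral_count_le.
Qed.

Let measurable_choice_sum b (f : nat -> BS -> R) : (1 <= b <= B)%N ->
  measurable_fun setT (fun w => \sum_((Kend b.-1).+1 <= k < (Kend b).+1) f k (a k w)).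
Proof.
by move=> bB; apply: measurable_sum_nat => k bk; exact: measurable_choice bB bk.
Qed.

Let sub_count := suboptimal_count a astar Kend.

Let measurable_sub_count b : (1 <= b <= B)%N ->
  measurable_fun setT (fun w => ((sub_count b w)%:R : R)%:E).
Proof.
move=> bB; apply/measurable_EFinP; rewrite /sub_count /suboptimal_count.
under eq_fun do rewrite natr_sum.
exact: (measurable_choice_sum (fun _ n => (n != astar b)%:R) bB).
Qed.

Lemma integral_suboptimal_count_le (b l N : nat) :
  (1 <= b <= B)%N -> (#|A b| <= N)%N -> (0 < l)%N ->
  8 * ln (Kend B)%:R <= l%:R * gap0 ^+ 2 ->
  (\int[P]_w ((sub_count b w)%:R : R)%:E <= (N%:R * (l%:R + 4))%:E)%E.
Proof.
move=> bB AN l0 lK.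
pose count n w : R :=
  (\sum_((Kend b.-1).+1 <= k < (Kend b).+1) (a k w == n))%N%:R.
(* Suboptimal choices are sorted by the station chosen, which is always an available one. *)
have -> : (\int[P]_w ((sub_count b w)%:R : R)%:E =
    \int[P]_w \sum_(n <- enum (A b :\ astar b)) (count n w)%:E)%E.
  apply: eq_integral => w _; rewrite big_enum sumEFin; congr (_%:E).
  rewrite -natr_sum exchange_big/=; congr (_%:R).
  rewrite /sub_count /suboptimal_count big_nat_cond [RHS]big_nat_cond.
  apply: eq_bigr => k; rewrite andbT ltnS => bk.
  have kA : a k w \in A b by apply: (choice_available ucb); rewrite /in_epoch bB.
  have [aks|aks] := eqVneq (a k w) (astar b).
    rewrite big1// => n; rewrite in_setD1 => /andP[ns _].
    by rewrite aks eq_sym (negbTE ns).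
  rewrite (bigD1 (a k w))/=; last by rewrite in_setD1 aks.
  by rewrite eqxx big1// => n /andP[_ nk]; rewrite eq_sym (negbTE nk).
have mcount n : measurable_fun setT (fun w => (count n w)%:E).
  apply/measurable_EFinP; rewrite /count; under eq_fun do rewrite natr_sum.
  exact: (measurable_choice_sum (fun _ n' => (n' == n)%:R) bB).
rewrite ge0_integral_sum//; last by move=> n w _; rewrite lee_fin.
apply: (@le_trans _ _ (\sum_(n in A b :\ astar b) (l%:R + 4)%:E)%E).
  rewrite big_enum/=; apply: lee_sum => n.
  by rewrite in_setD1 => /andP[ns nA]; exact: integral_choices_le.
rewrite sumEFin lee_fin sumr_const -[leLHS]mulr_natl ler_wpM2r ?addr_ge0// ler_nat.
by apply: leq_trans AN; rewrite subset_leq_card// subsetDl.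
Qed.

Let z_le_beta n : z n <= beta.
Proof.
rewrite -lee_fin -(EZ n 0) -(expectation_cst P beta); apply: expectation_le => //.
- by move=> w; case/andP: (Zb n 0 w).
- by move=> w; exact: ltW.
- by apply: aeW => w; case/andP: (Zb n 0 w).
Qed.

Let z_ge0 n : 0 <= z n.
Proof.
by rewrite -lee_fin -(EZ n 0); apply: expectation_ge0 => w; case/andP: (Zb n 0 w).
Qed.

(** Costs are means of observations in [0, beta], so a suboptimal choice costs at most beta and an
    optimal one costs nothing. *)
Lemma expected_epoch_regret_le (b l N : nat) :
  (1 <= b <= B)%N -> (#|A b| <= N)%N -> (0 < l)%N ->
  8 * ln (Kend B)%:R <= l%:R * gap0 ^+ 2 ->
  ('E_P[epoch_regret Kend z astar a b] <= (beta * (N%:R * (l%:R + 4)))%:E)%E.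
Proof.
move=> bB AN l0 lK; have [_ zs] := astar_available bB.
rewrite unlock; apply: (@le_trans _ _ (\int[P]_w (beta%:E *
  ((sub_count b w)%:R)%:E))%E).
  apply: ge0_le_integral => //.
  - move=> w _; rewrite lee_fin /epoch_regret big_nat_cond sumr_ge0// => k.
    rewrite andbT ltnS => bk; rewrite subr_ge0 zs//.
    by apply: (choice_available ucb); rewrite /in_epoch bB.
  - by apply/measurable_EFinP;
    exact: (measurable_choice_sum (fun _ n => z n - z (astar b)) bB).
  - by apply: measurable_funeM; exact: measurable_sub_count.
  - move=> w _; rewrite -EFinM lee_fin /epoch_regret /sub_count /suboptimal_count
    natr_sum mulr_sumr.
    apply: ler_sum => k _; case: eqP => [->|_]; first by rewrite subrr mulr0.
    by rewrite mulr1; have := z_le_beta (a k w); have := z_ge0 (astar b); lra.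
rewrite ge0_integralZl//; last 2 first.
- exact: measurable_sub_count.
- by rewrite lee_fin ltW.
by rewrite EFinM lee_pmul2l ?lte_fin//; exact: integral_suboptimal_count_le.
Qed.

Lemma expected_handovers_le (l N : nat) :
  (forall b, (1 <= b <= B)%N -> (#|A b| <= N)%N) -> (0 < l)%N ->
  8 * ln (Kend B)%:R <= l%:R * gap0 ^+ 2 ->
  ('E_P[handovers R (Kend B) a] <= (B%:R + 2 * (B%:R * (N%:R * (l%:R + 4))))%:E)%E.
Proof.
move=> AN l0 lK.
rewrite unlock; apply: (@le_trans _ _ (\int[P]_w ((B%:R : R)%:E +
    2%:E * \sum_(b < B) ((sub_count b.+1 w)%:R)%:E))%E).
  apply: ge0_le_integral => //.
  - by move=> w _; rewrite lee_fin /handovers sumr_ge0.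
  - apply/measurable_EFinP; rewrite /handovers;
    apply: measurable_sum_nat => k /andP[k1 kK].
    apply: (@measurable_fin_comp _ _ _ (BS * BS)%type (fun nn => (nn.1 != nn.2)%:R)
      (fun w => (a k w, a k.-1 w))) => -[n n'].
    rewrite (_ : [set w | _] = [set w | a k w = n] `&` [set w | a k.-1 w = n']).
      by apply: measurableI; apply: ma; lia.
    by apply/seteqP; split => w /= [-> ->].
  - apply: emeasurable_funD => //; apply: measurable_funeM.
    by apply: emeasurable_sum => b; apply: measurable_sub_count; rewrite /= ltn_ord.
  - move=> w _; rewrite sumEFin -EFinM -EFinD lee_fin /handovers -!natr_sum.
    rewrite -[2 * _]natrM -natrD ler_nat.
    apply: leq_trans (handovers_le a astar w Kends) _.
    by rewrite big_add1/= big_mkord.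
have mS (b : 'I_B) : measurable_fun setT (fun w => ((sub_count b.+1 w)%:R : R)%:E).
  by apply: measurable_sub_count; rewrite /= ltn_ord.
have S0 w : (0 <= \sum_(b < B) ((sub_count b.+1 w)%:R : R)%:E)%E.
  by apply: sume_ge0 => b _; rewrite lee_fin.
rewrite ge0_integralD//; last 2 first.
- by move=> w _; rewrite mule_ge0.
- by apply: measurable_funeM; exact: emeasurable_sum.
rewrite integral_cst// [X in (_ * X + _)%E](_ : _ = 1%E);
  last exact: probability_setT.
rewrite mule1 [leRHS]EFinD leeD2l// ge0_integralZl//; last exact: emeasurable_sum.
rewrite EFinM lee_pmul2l// ge0_integral_sum//.
apply: (@le_trans _ _ (\sum_(b < B) (N%:R * (l%:R + 4))%:E)%E).
  apply: lee_sum => b _; have bB : (1 <= b.+1 <= B)%N by rewrite /= ltn_ord.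
  exact: integral_suboptimal_count_le bB (AN _ bB) l0 lK.
by rewrite sumEFin lee_fin sumr_const card_ord -[leLHS]mulr_natl.
Qed.

End ExpectedCounts.

(** * Assembling the bounds and choosing the constant *)

Theorem proposition2 (R : realType) (V C beta gap0 : R) (N : nat)
    (V_gt0 : 0 < V) (C_ge0 : 0 <= C) (beta_gt0 : 0 < beta)
    (gap0_gt0 : 0 < gap0) :
  exists c : R,
  forall (B K : nat) (Kend : nat -> nat)
    (BS : finType) (A : nat -> {set BS}) (u v : BS -> nat)
    (q : R) (dl en : BS -> R) (astar : nat -> BS)
    (d : measure_display) (T : measurableType d) (P : probability T R)
    (Dl En : BS -> nat -> {RV P >-> R}) (a : nat -> T -> BS),
  let z := cost V q dl en in
  let Z := obs V q Dl En in
  (1 <= B)%N -> (2 <= K)%N -> Kend B = K -> epoch_ends B Kend ->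
  (forall b, (1 <= b <= B)%N -> A b != finset.set0) ->
  lifespans B Kend A u v ->
  0 <= q -> (forall n, 0 <= z n) ->
  mutually_independent (fun nj : BS * nat => Z nj.1 nj.2) ->
  (forall n i j (E : set R), measurable E ->
     distribution P (Z n i) E = distribution P (Z n j) E) ->
  (forall n j, 'E_P[Z n j] = (z n)%:E)%E ->
  (forall n j w, 0 <= Z n j w <= beta) ->
  (forall b, (1 <= b <= B)%N -> argmin (A b) z = finset.set1 (astar b)) ->
  (forall b, (1 <= b <= B)%N -> (#|A b| <= N)%N) ->
  (forall b n, (1 <= b <= B)%N -> n \in A b -> n != astar b ->
     gap0 <= gap beta z astar n b) ->
  (forall k n, (1 <= k <= K)%N -> measurable [set w | a k w = n]) ->
  vucb1 (fun n j => Z n j) a beta B Kend A u ->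
  (regret P V C B Kend z astar a <= (c * B%:R * ln K%:R)%:E)%E.
Proof.
have ln2 : 0 < ln 2 :> R by rewrite ln_gt0// ltr1n.
(* The bounds add up to B ((beta + 2 V C) N (l + 4) + V C) with l <= 8 ln K / gap0^2 + 1. The
   additive constants 5 and 1 are absorbed by 1 <= ln K / ln 2, valid as K >= 2. *)
exists ((beta + 2 * V * C) * (N%:R * (8 / gap0 ^+ 2 + 5 / ln 2)) + V * C / ln 2).
move=> B K Kend BS A u v q dl en astar d T P Dl En a z Z B1 K2 KB Kends A0 uv q0 z0.
move=> indepZ identZ EZ Zb best AN gaps ma ucb.
have lnK : ln 2 <= ln K%:R :> R
  by rewrite ler_ln ?posrE ?ltr0n ?ler_nat// (leq_trans _ K2).
have lnK0 : 0 < ln K%:R :> R by exact: lt_le_trans lnK.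
have g20 : 0 < gap0 ^+ 2 by rewrite exprn_gt0.
pose x := 8 * ln K%:R / gap0 ^+ 2.
have x0 : 0 <= x by rewrite divr_ge0 ?mulr_ge0// ltW.
have /andP[lx xl] := truncn_itv x0.
(* The integer part plus one is positive and lies between x and x + 1, as needed for the threshold
   on uses. *)
set l := (Num.truncn x).+1 in xl.
have lle : l%:R <= x + 1 by rewrite /l -natr1 lerD2r.
have lK : 8 * ln (Kend B)%:R <= l%:R * gap0 ^+ 2.
  by rewrite KB -ler_pdivrMr// ltW.
rewrite -KB in ma.
have VC0 : 0 <= V * C by rewrite mulr_ge0// ltW.
pose M : R := N%:R * (l%:R + 4).
have ER b : (1 <= b <= B)%N ->
    ('E_P[epoch_regret Kend z astar a b] <= (beta * M)%:E)%E.
  by move=> bB; exact: (expected_epoch_regret_le beta_gt0 gap0_gt0 Kends uv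
    indepZ EZ Zb best gaps ma ucb bB (AN b bB) _ lK).
have HO : ('E_P[handovers R (Kend B) a] <= (B%:R + 2 * (B%:R * M))%:E)%E.
  exact: (expected_handovers_le beta_gt0 gap0_gt0 Kends uv indepZ EZ Zb best gaps
    ma ucb AN _ lK).
apply: (@le_trans _ _ (\sum_(1 <= b < B.+1) (beta * M)%:E
    + (V * C)%:E * (B%:R + 2 * (B%:R * M))%:E)%E).
  apply: leeD; last by apply: lee_wpmul2l; rewrite ?lee_fin.
  by rewrite big_nat_cond [leRHS]big_nat_cond; apply: lee_sum => b;
    rewrite andbT ltnS; exact: ER.
rewrite sumEFin -EFinM -EFinD lee_fin sumr_const_nat subSS subn0 -[_ *+ B]mulr_natl.
have ML : M <= N%:R * (8 / gap0 ^+ 2 + 5 / ln 2) * ln K%:R.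
  rewrite -mulrA ler_wpM2l// mulrDl (le_trans (lerD lle (lexx _)))//.
  have -> : 8 / gap0 ^+ 2 * ln K%:R = x by rewrite /x mulrAC.
  rewrite -addrA lerD2l [1 + 4](_ : _ = 5); last by ring.
  by rewrite mulrAC -mulrA ler_peMr// ler_pdivlMr// mul1r.
have L1 : 1 <= ln K%:R / ln 2 :> R by rewrite ler_pdivlMr// mul1r.
have -> : B%:R * (beta * M) + V * C * (B%:R + 2 * (B%:R * M)) =
    B%:R * ((beta + 2 * V * C) * M + V * C) by ring.
rewrite [leRHS]mulrAC [leRHS]mulrC ler_wpM2l// [leRHS]mulrDl lerD//.
  by rewrite -[leRHS]mulrA ler_wpM2l// addr_ge0 ?(ltW beta_gt0)// -mulrA mulr_ge0.
by rewrite -[leRHS]mulrA [_^-1 * _]mulrC ler_peMr.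
Qed.
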